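(* Let $d,m\in\mathbb{N}$, let $\mathcal{X}\subseteq\mathbb{R}^d$ be a bounded domain, $\mathcal{Y}=\{-1,1\}$, $\mathcal{Z}=\mathcal{X}\times\mathcal{Y}$, and let $\rho$ be a probability distribution on $\mathcal{Z}$. Let ${\bf z}=\{z_i=(x_i,y_i): i=1,\dots,m\}$ be drawn i.i.d. from $\rho$. Fix $r>0$, $\lambda>0$ and a matrix norm $\|\cdot\|$ on $d\times d$ matrices. For symmetric $A\in\mathbb{S}^{d\times d}$ let $K_A(x,x')=x^TAx'$ and $$\mathcal{E}_{\bf z}(A)=\frac1m\sum_{i=1}^m\Big(1-\frac{1}{mr}\sum_{j=1}^m y_iy_jK_A(x_i,x_j)\Big)_+,$$ and let $A_{\bf z}\in\arg\min_{A\in\mathbb{S}^{d\times d}}\big[\mathcal{E}_{\bf z}(A)+\lambda\|A\|\big]$. Let $$f_{\bf z}\in\arg\min\Big\{\frac1m\sum_{i=1}^m(1-y_if(x_i))_+ : f=\sum_{j=1}^m\alpha_jK_{A_{\bf z}}(x_j,\cdot),\ \alpha_j\in\mathbb{R},\ \sum_{j=1}^m|\alpha_j|\le 1/r\Big\},$$ and for a function $f:\mathcal{X}\to\mathbb{R}$ let $\mathscr{E}(f)=\int_{\mathcal{Z}}(1-yf(x))_+\,d\rho(x,y)$. Then for any $0<\delta<1$, with probability at least $1-\delta$ over ${\bf z}$, $$\mathscr{E}(f_{\bf z})\le \mathcal{E}_{\bf z}(A_{\bf z})+\frac{4\mathcal{R}_m}{\lambda r}+\frac{2X_*}{\lambda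 r}\sqrt{\frac{2\log(1/\delta)}{m}},$$ where $X_*=\sup_{x,x'\in\mathcal{X}}\|x'x^T\|_*$ and $\mathcal{R}_m=\mathbb{E}_{{\bf z},\sigma}\Big[\sup_{\tilde x\in\mathcal{X}}\Big\|\frac1m\sum_{i=1}^m\sigma_iy_ix_i\tilde x^T\Big\|_*\Big]$.
   Context: $(t)_+=\max(t,0)$. The dual norm is $\|B\|_*=\sup_{\|A\|\le1}\mathrm{trace}(B^TA)$. In $\mathcal{R}_m$, $\sigma_1,\dots,\sigma_m$ are i.i.d. Rademacher variables ($P(\sigma_i=\pm1)=1/2$) independent of ${\bf z}$, and the expectation is over both ${\bf z}$ and $\sigma$. $\mathbb{S}^{d\times d}$ denotes the symmetric $d\times d$ real matrices. *)

(* Defs.v *)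
From HB Require Import structures.
From mathcomp Require Import all_boot all_order all_algebra.
From mathcomp Require Import all_classical all_reals all_analysis.
Set Implicit Arguments. Unset Strict Implicit. Unset Printing Implicit Defensive.
Import Order.TTheory GRing.Theory Num.Theory.
Import numFieldNormedType.Exports.
Local Open Scope classical_set_scope.
Local Open Scope ring_scope.

Section defs.
Variable R : realType.

Definition Zt (d : nat) := (d.-tuple R * R)%type.

Definition vec d (t : d.-tuple R) : 'cV[R]_d := \col_(i < d) tnth t i.

Definition bounded_domain d (X : set 'cV[R]_d) :=
  X !=set0 /\ open X /\ connected X /\ bounded_set X.

Definition matrix_norm d (N : 'M[R]_d -> R) :=
  [/\ forall A, N A = 0 -> A = 0,
      forall (a : R) A, N (a *: A) = `|a| * N A
    & forall A B, N (A + B) <= N A + N B].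

Definition dual_norm d (N : 'M[R]_d -> R) (B : 'M[R]_d) : R :=
  sup [set \tr (B^T *m A) | A in [set A : 'M[R]_d | N A <= 1]].

Definition sym_mx d : set 'M[R]_d := [set A | A^T = A].

Definition KA d (A : 'M[R]_d) (x x' : 'cV[R]_d) : R := (x^T *m A *m x') 0 0.

Definition hinge (t : R) : R := Num.max 0 t.

Definition xs d m (s : 'I_m -> Zt d) (i : 'I_m) : 'cV[R]_d := vec (s i).1.
Definition ys d m (s : 'I_m -> Zt d) (i : 'I_m) : R := (s i).2.

Definition emp_err d m (r : R) (s : 'I_m -> Zt d) (A : 'M[R]_d) : R :=
  m%:R^-1 * \sum_(i < m) hinge (1 - (m%:R * r)^-1 *
     \sum_(j < m) ys s i * ys s j * KA A (xs s i) (xs s j)).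

Definition fA d m (s : 'I_m -> Zt d) (A : 'M[R]_d) (alpha : 'I_m -> R)
  (x : 'cV[R]_d) : R := \sum_(j < m) alpha j * KA A (xs s j) x.

Definition emp_hinge d m (s : 'I_m -> Zt d) (f : 'cV[R]_d -> R) : R :=
  m%:R^-1 * \sum_(i < m) hinge (1 - ys s i * f (xs s i)).

Definition gen_err d (rho : probability (Zt d) R) (f : 'cV[R]_d -> R)
  : \bar R :=
  (\int[rho]_z (hinge (1 - z.2 * f (vec z.1)))%:E)%E.

Definition Xstar d (N : 'M[R]_d -> R) (X : set 'cV[R]_d) : R :=
  sup [set dual_norm N (p.2 *m p.1^T) | p in X `*` X].

Definition sgn (b : bool) : R := if b then 1 else -1.

Definition rad_sup d m (N : 'M[R]_d -> R) (X : set 'cV[R]_d)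
  (s : 'I_m -> Zt d) (sigma : {ffun 'I_m -> bool}) : R :=
  sup [set dual_norm N (m%:R^-1 *:
         \sum_(i < m) (sgn (sigma i) * ys s i) *: (xs s i *m xt^T))
      | xt in X].

Definition iid_sample d0 (Omega : measurableType d0) (P : probability Omega R)
  d m (Zs : 'I_m -> Omega -> Zt d) (rho : probability (Zt d) R) :=
  [/\ forall i, measurable_fun setT (Zs i),
      forall i (B : set (Zt d)), measurable B ->
        P (Zs i @^-1` B) = rho B
    & forall B : 'I_m -> set (Zt d), (forall i, measurable (B i)) ->
        P (\bigcap_(i in [set: 'I_m]) (Zs i @^-1` B i)) =
        (\prod_(i < m) fine (P (Zs i @^-1` B i)))%:E].

Definition sample d0 (Omega : measurableType d0) d m
  (Zs : 'I_m -> Omega -> Zt d) (w : Omega) : 'I_m -> Zt d := fun i => Zs i w.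

Definition rademacher d0 (Omega : measurableType d0) (P : probability Omega R)
  d m (Zs : 'I_m -> Omega -> Zt d) (N : 'M[R]_d -> R) (X : set 'cV[R]_d)
  : \bar R :=
  (\int[P]_w ((2 ^ m)%:R^-1 *
     \sum_(sigma : {ffun 'I_m -> bool}) rad_sup N X (sample Zs w) sigma)%:E)%E.

End defs.

(* Main.v *)
Require Import Defs.
From HB Require Import structures.
From mathcomp Require Import all_boot all_order all_algebra.
From mathcomp Require Import all_classical all_reals all_analysis.
From mathcomp Require Import measurable_realfun.
From mathcomp Require Import ring lra.
Import Order.TTheory GRing.Theory Num.Theory.
Import numFieldNormedType.Exports.
Local Open Scope classical_set_scope.
Local Open Scope ring_scope.

(** Comparing [A_z] with [0] gives [N (A_z) <= 1 / lambda], so [f_z] belongs to a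
class [F] that does not depend on the sample: the functions
[sum_j beta_j x_j^T A x] with [A] symmetric, [N A <= 1 / lambda],
[sum_j |beta_j| <= 1 / r] and [x_j] in [X]. The uniform deviation of the hinge
risk over [F] concentrates around its mean (McDiarmid), the mean is at most twice
the Rademacher complexity of [F] (symmetrization and contraction), and by duality
that complexity is at most [R_m / (lambda r)]. Finally [beta_j = y_j / (m r)]
shows that the empirical hinge risk of [f_z] is at most [E_z (A_z)].

No measurability of suprema over [F] is used. The sample space is cut into
finitely many cells on which all functions of [F] vary by [O(eta)], and the
probabilistic argument is run on the finite product space of cells; this gives
the bound up to [O(eta)] on an event of probability at least [1 - delta]. The
superior limit of these events as [eta] tends to [0] still has probability at least
[1 - delta], and on it the exact bound holds. *)

Set Implicit Arguments. Unset Strict Implicit. Unset Printing Implicit Defensive.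

(** * Concentration on finite product spaces *)

Lemma sinh_le_xcosh (R : realType) (x : R) : 0 <= x ->
  expR x - expR (- x) <= x * (expR x + expR (- x)).
Proof.
move=> x0.
pose f := fun y : R => expR y - expR (- y) - y * (expR y + expR (- y)).
have df (y : R) : is_derive y 1 f (- (y * (expR y - expR (- y)))).
  by apply: is_derive_eq; rewrite /GRing.scale /=; ring.
suff : f x <= f 0 by rewrite /f oppr0 expR0; lra.
have dfy (y : R) : derivable f y 1 by have [] := df y.
have f'le (y : R) : y \in `]0, +oo[%R -> derive1 f y <= 0.
  rewrite in_itv /= andbT => y0.
  rewrite derive1E (@derive_val _ _ _ _ _ _ _ (df y)).
  rewrite oppr_le0 mulr_ge0 ?ltW// subr_gt0 ltr_expR; lra.
apply: (ler0_derive1_nincry _ f'le) => //.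
by apply: derivable_within_continuous.
Qed.

(** For [y > 0] the product of [exp (- y^2 / 2)] and [exp y + exp (- y)] does not increase: its
    derivative has the sign of [sinh y - y cosh y], see [sinh_le_xcosh]. At [0] it equals [2]. *)
Lemma cosh_le_expR (R : realType) (x : R) :
  (expR x + expR (- x)) / 2 <= expR (x ^+ 2 / 2).
Proof.
wlog x0 : x / 0 <= x.
  move=> h; have [/h//|x0] := leP 0 x.
  by have := h (- x); rewrite opprK sqrrN addrC; apply; rewrite oppr_ge0 ltW.
pose f := fun y : R => expR (- (y ^+ 2 / 2)) * (expR y + expR (- y)).
have df (y : R) : is_derive y 1 f
    (expR (- (y ^+ 2 / 2)) * (expR y - expR (- y) - y * (expR y + expR (- y)))).
  by apply: is_derive_eq; rewrite /GRing.scale /=; field.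
suff : f x <= f 0.
  rewrite {2}/f expr0n /= mul0r oppr0 expR0 /f expRN mulrC ler_pdivrMr ?expR_gt0 //; lra.
have dfy (y : R) : derivable f y 1 by have [] := df y.
have f'le (y : R) : y \in `]0, +oo[%R -> derive1 f y <= 0.
  rewrite in_itv /= andbT => y0.
  rewrite derive1E (@derive_val _ _ _ _ _ _ _ (df y)) pmulr_rle0 ?expR_gt0// subr_le0.
  exact/sinh_le_xcosh/ltW.
apply: (ler0_derive1_nincry _ f'le) => //.
by apply: derivable_within_continuous.
Qed.

(** Convexity: [x] is the combination of [c] and [- c] with weight [(x + c) / (2 c)] on [c]. *)
Lemma expR_le_chord (R : realType) (c x : R) : `|x| <= c -> 0 < c ->
  expR x <= (expR c + expR (- c)) / 2 + x / c * ((expR c - expR (- c)) / 2).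
Proof.
move=> /[!ler_norml]/andP[xc1 xc2] c0.
have t01 : 0 <= (x + c) / (2 * c) <= 1.
  by rewrite divr_ge0 ?ler_pdivrMr; lra.
have := convex_expR (Itv01 (andP t01).1 (andP t01).2) c (- c).
rewrite !convRE /= /unstable.onem.
suff -> : (x + c) / (2 * c) * c + (1 - (x + c) / (2 * c)) * - c = x.
  move/le_trans; apply; rewrite le_eqVlt; apply/orP; left; apply/eqP.
  by field; lra.
by field; lra.
Qed.

Section product_expectation.
Variables (R : realType) (T : finType) (p : T -> R).

(** Expectation over words of [n] independent letters with weights [p]. Since [g] takes lists,
    inductions on [n] peel off a letter without casts. *)
Definition EE n (g : seq T -> R) : R :=
  \sum_(u : n.-tuple T) (\prod_(i < n) p (tnth u i)) * g u.

Lemma EE0 g : EE 0 g = g [::].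
Proof.
rewrite /EE (bigD1 [tuple])//= big_ord0 mul1r big1 ?addr0// => u.
by move=> /eqP[]; exact: tuple0.
Qed.

Lemma EES n g : EE n.+1 g = \sum_t p t * EE n (fun u => g (t :: u)).
Proof.
rewrite /EE; under [RHS]eq_bigr do rewrite big_distrr /=.
rewrite pair_big /= (reindex (fun q : T * n.-tuple T => cons_tuple q.1 q.2)) /=.
  apply: eq_bigr => -[t u] _ /=; rewrite big_ord_recl mulrA tnth0.
  by congr (_ * _ * _); apply: eq_bigr => i _; rewrite tnthS.
exists (fun u => (thead u, [tuple of behead u])) => [[t u] _ | u _] /=.
  by congr pair; apply: val_inj.
by apply: val_inj => /=; rewrite [in RHS](tuple_eta u).
Qed.

Lemma EE_sum (I : Type) (r : seq I) n (g : I -> seq T -> R) :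
  EE n (fun u => \sum_(i <- r) g i u) = \sum_(i <- r) EE n (g i).
Proof.
by rewrite exchange_big; apply: eq_bigr => u _; rewrite big_distrr.
Qed.

Lemma EEZ n k g : EE n (fun u => k * g u) = k * EE n g.
Proof. by rewrite big_distrr; apply: eq_bigr => u _; rewrite mulrCA. Qed.

Hypothesis p0 : forall t, 0 <= p t.

Lemma EE_le_tuple n (f g : seq T -> R) :
  (forall u : n.-tuple T, f u <= g u) -> EE n f <= EE n g.
Proof.
by move=> fg; apply: ler_sum => u _; apply: ler_wpM2l => //; exact: prodr_ge0.
Qed.

Lemma EE_le n f g : (forall u, size u = n -> f u <= g u) -> EE n f <= EE n g.
Proof. by move=> fg; apply: EE_le_tuple => u; rewrite fg ?size_tuple. Qed.

Lemma EE_eq n f g : (forall u, size u = n -> f u = g u) -> EE n f = EE n g.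
Proof. by move=> fg; apply: eq_bigr => u _; rewrite fg ?size_tuple. Qed.

Hypothesis p1 : \sum_t p t = 1.

Lemma EE_cst n k : EE n (fun=> k) = k.
Proof. by elim: n => [|n IH]; rewrite ?EE0// EES IH -big_distrl /= p1 mul1r. Qed.

Lemma EED n f g : EE n (fun u => f u + g u) = EE n f + EE n g.
Proof. by rewrite -big_split /=; apply: eq_bigr => u _; rewrite mulrDr. Qed.

(** The chord bound is affine in [D t], and the zero mean removes its linear term; [cosh c]
    remains. *)
Lemma mgf_le (c : R) (D : T -> R) : (forall t, `|D t| <= c) ->
  \sum_t p t * D t = 0 -> \sum_t p t * expR (D t) <= expR (c ^+ 2 / 2).
Proof.
move=> Dc D0; have [c0|c0] := ltP 0 c; last first.
  have DE t : D t = 0 by apply/eqP; rewrite -normr_le0 (le_trans (Dc t)).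
  under eq_bigr do rewrite DE expR0 mulr1.
  by rewrite p1 -expR0 ler_expR divr_ge0 ?sqr_ge0.
apply: le_trans (cosh_le_expR c).
apply: (@le_trans _ _ (\sum_t (p t * ((expR c + expR (- c)) / 2) +
    (p t * D t) * (c^-1 * ((expR c - expR (- c)) / 2))))).
  apply: ler_sum => t _; rewrite -!mulrA -mulrDr ler_wpM2l//.
  by rewrite [D t * _]mulrA; exact: expR_le_chord.
by rewrite big_split /= -!big_distrl /= p1 D0 mul0r addr0 mul1r.
Qed.

Definition bounded_differences n (g : seq T -> R) (c : R) :=
  forall u v t t', (size u + size v).+1 = n ->
    `|g (u ++ t :: v) - g (u ++ t' :: v)| <= c.

(** Induction on the first letter [t]: its conditional mean [G t] differs from the total mean by an
    average of differences [G t - G t'], so [mgf_le] gives one factor, and the induction hypothesis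
    for [g (t :: _)] gives the others. *)
Lemma EE_expR_le n g c : bounded_differences n g c ->
  EE n (fun u => expR (g u - EE n g)) <= expR (n%:R * (c ^+ 2 / 2)).
Proof.
elim: n g => [|n IH] g bg; first by rewrite !EE0 subrr mul0r.
pose G t := EE n (fun u => g (t :: u)).
have EG : EE n.+1 g = \sum_t p t * G t by rewrite EES.
have Gc t t' : `|G t - G t'| <= c.
  have -> : G t - G t' = EE n (fun u => g (t :: u) - g (t' :: u)).
    by rewrite EED /G; congr (_ + _); rewrite -mulN1r -EEZ; apply: EE_eq => u _;
       rewrite mulN1r.
  rewrite ler_norml; apply/andP; split;
    [rewrite -[leLHS](EE_cst n)|rewrite -[leRHS](EE_cst n)];
    apply: EE_le => u un; have := bg [::] u t t';
    by rewrite add0n un ler_norml => /(_ erefl)/andP[].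
rewrite EES; apply: (@le_trans _ _ (\sum_t p t * expR (G t - EE n.+1 g)
   * expR (n%:R * (c ^+ 2 / 2)))).
  apply: ler_sum => t _; rewrite -mulrA ler_wpM2l//.
  have -> : EE n (fun u => expR (g (t :: u) - EE n.+1 g)) =
      expR (G t - EE n.+1 g) * EE n (fun u => expR (g (t :: u) - G t)).
    by rewrite -EEZ; apply: EE_eq => u _; rewrite -expRD; congr expR; ring.
  rewrite ler_wpM2l ?expR_ge0//; apply: IH => u v s s' uv.
  by rewrite -!cat_cons; apply: bg; rewrite /= addSn uv.
rewrite -big_distrl /= -(natr1 n) mulrDl mul1r expRD mulrC ler_wpM2l ?expR_ge0//.
apply: mgf_le => [t|].
  rewrite EG -[G t]mul1r -p1 big_distrl /= -sumrB.
  apply: le_trans (ler_norm_sum _ _ _) _.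
  rewrite -[leRHS]mul1r -p1 big_distrl /=; apply: ler_sum => t' _.
  by rewrite -mulrBr normrM (ger0_norm (p0 t')) ler_wpM2l.
under eq_bigr do rewrite mulrBr.
by rewrite sumrB -EG -big_distrl /= p1 mul1r subrr.
Qed.

Lemma bounded_differencesZ n g c k : bounded_differences n g c ->
  bounded_differences n (fun u => k * g u) (`|k| * c).
Proof. by move=> bg u v t t' uv; rewrite -mulrBr normrM ler_wpM2l// bg. Qed.

(* The bound [cosh x <= exp (x^2 / 2)] on centered variables ranging over [[-c, c]]
   replaces Hoeffding's lemma; it costs a factor 2 in the deviation. *)
Lemma mcdiarmid n g c L : (0 < n)%N -> 0 < c -> 0 <= L ->
  bounded_differences n g c ->
  EE n (fun u => (EE n g + c * Num.sqrt (2 * L * n%:R) < g u)%R%:R) <= expR (- L).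
Proof.
move=> n0 c0 L0 bg; set q := Num.sqrt _.
have nR : 0 < n%:R :> R by rewrite ltr0n.
(* This [th] minimizes the Chernoff exponent [n (th c)^2 / 2 - th c q]; the minimum is
   [- q^2 / (2 n) = - L]. *)
pose th := q / (n%:R * c).
have q0 : 0 <= q by exact: sqrtr_ge0.
have q2 : q ^+ 2 = 2 * L * n%:R by rewrite sqr_sqrtr// !mulr_ge0.
have th0 : 0 <= th by rewrite divr_ge0// mulr_ge0// ltW.
apply: (@le_trans _ _ (EE n (fun u =>
    expR (- (th * (c * q))) * expR (th * g u - EE n (fun u => th * g u))))).
  apply: EE_le => u _; case: ltP => [gu|_]; last by rewrite mulr_ge0 ?expR_ge0.
  rewrite -expRD EEZ -mulrBr addrC -mulrBr -expR0 ler_expR mulr_ge0//; lra.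
rewrite EEZ; apply: le_trans (ler_wpM2l (expR_ge0 _)
  (EE_expR_le (@bounded_differencesZ n g c th bg))) _.
rewrite -expRD ler_expR ger0_norm// le_eqVlt; apply/orP; left; apply/eqP.
have -> : th * c = q / n%:R by rewrite /th; field; rewrite !lt0r_neq0.
have -> : th * (c * q) = q ^+ 2 / n%:R by rewrite /th; field; rewrite !lt0r_neq0.
by rewrite expr_div_n q2; field; rewrite lt0r_neq0.
Qed.

End product_expectation.

(** * Symmetrization and contraction *)

Section symmetrization.
Variables (R : realType) (I : Type) (F : set I).
Hypothesis F0 : F !=set0.

Definition bounded_on (a : I -> R) := exists C, forall h, F h -> `|a h| <= C.

Lemma bounded_onD a b : bounded_on a -> bounded_on b ->
  bounded_on (fun h => a h + b h).
Proof.
move=> [C aC] [D bD]; exists (C + D) => h Fh.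
by rewrite (le_trans (ler_normD _ _))// lerD ?aC ?bD.
Qed.

Lemma bounded_onZ k a : bounded_on a -> bounded_on (fun h => k * a h).
Proof.
by move=> [C aC]; exists (`|k| * C) => h Fh; rewrite normrM ler_wpM2l// aC.
Qed.

Lemma bounded_onN a : bounded_on a -> bounded_on (fun h => - a h).
Proof. by move=> [C aC]; exists C => h Fh; rewrite normrN aC. Qed.

Lemma bounded_onB a b : bounded_on a -> bounded_on b ->
  bounded_on (fun h => a h - b h).
Proof. by move=> ba /bounded_onN; exact: bounded_onD. Qed.

Lemma bounded_on_cst k : bounded_on (fun=> k).
Proof. by exists `|k|. Qed.

Lemma bounded_on_sum (J : Type) (r : seq J) (a : J -> I -> R) :
  (forall j, bounded_on (a j)) -> bounded_on (fun h => \sum_(j <- r) a j h).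
Proof.
move=> ba; elim: r => [|j r IH].
  by under eq_fun do rewrite big_nil; exact: bounded_on_cst.
by under eq_fun do rewrite big_cons; exact: bounded_onD.
Qed.

Definition supF (a : I -> R) := sup (a @` F).

Lemma supF_ge a h : bounded_on a -> F h -> a h <= supF a.
Proof.
move=> [C aC] Fh; apply: ub_le_sup; last by exists h.
by exists C => _ [k Fk <-]; rewrite (le_trans (ler_norm _))// aC.
Qed.

Lemma supF_le a x : (forall h, F h -> a h <= x) -> supF a <= x.
Proof.
move=> ax; apply: ge_sup; last by move=> _ [h Fh <-]; exact: ax.
by case: F0 => h Fh; exists (a h); exists h.
Qed.

Lemma supF_eq a b : (forall h, F h -> a h = b h) -> supF a = supF b.
Proof.
move=> ab; congr sup; rewrite predeqE => x; split=> -[h Fh <-]; exists h => //.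
  by rewrite ab.
by rewrite -ab.
Qed.

Variables (T : finType) (p : T -> R).
Hypotheses (p0 : forall t, 0 <= p t) (p1 : \sum_t p t = 1).
Variable l : R -> R.
Hypothesis l_lip : forall x y, `|l x - l y| <= `|x - y|.
Variables (h : I -> T -> R) (B : R).
Hypothesis hB : forall i t, F i -> `|h i t| <= B.

Definition expl i := \sum_t p t * l (h i t).

Lemma bounded_h t : bounded_on (h ^~ t).
Proof. by exists B => i /hB. Qed.

Lemma bounded_l t : bounded_on (fun i => l (h i t)).
Proof.
exists (B + `|l 0|) => i Fi; rewrite -[l _](subrK (l 0)).
by rewrite (le_trans (ler_normD _ _))// lerD2r (le_trans (l_lip _ _))// subr0 hB.
Qed.

Lemma bounded_expl : bounded_on expl.
Proof. by apply: bounded_on_sum => t; exact/bounded_onZ/bounded_l. Qed.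

(* Talagrand's contraction for a single sign: in [a(i) + 2 l(h i) + a(j) - 2 l(h j)]
   the Lipschitz bound replaces [l(h i) - l(h j)] by [|h i - h j|], and the
   absolute value is removed by exchanging the roles of [i] and [j]. *)
Lemma contraction1 a t : bounded_on a ->
  supF (fun i => a i + 2 * l (h i t)) + supF (fun i => a i - 2 * l (h i t)) <=
  supF (fun i => a i + 2 * h i t) + supF (fun i => a i - 2 * h i t).
Proof.
move=> ba; rewrite -lerBrDr; apply: supF_le => i Fi.
rewrite lerBrDr addrC -lerBrDr; apply: supF_le => j Fj.
have bp : bounded_on (fun i => a i + 2 * h i t).
  exact/bounded_onD/bounded_onZ/bounded_h.
have bm : bounded_on (fun i => a i - 2 * h i t).
  exact/bounded_onB/bounded_onZ/bounded_h.
have := supF_ge bp Fi; have := supF_ge bp Fj.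
have := supF_ge bm Fi; have := supF_ge bm Fj.
have := l_lip (h i t) (h j t).
have [ij|ij] := leP 0 (h i t - h j t).
  by rewrite (ger0_norm ij) => /ler_normlW; lra.
by rewrite (ltr0_norm ij) => /ler_normlW; lra.
Qed.

(** Write [expl] with an independent copy [t'] of [t]. Splitting [a i] evenly between
    [a i + 2 l (h i t')] and [a i - 2 l (h i t)] separates the suprema; as [t] and [t'] have the
    same law, both may be read at one letter, where [contraction1] applies. *)
Lemma symmetrization1 a : bounded_on a ->
  \sum_t p t * supF (fun i => a i + (expl i - l (h i t))) <=
  \sum_t p t * ((supF (fun i => a i + 2 * h i t) +
                 supF (fun i => a i - 2 * h i t)) / 2).
Proof.
move=> ba.
pose Qp t := supF (fun i => a i + 2 * l (h i t)).
pose Qm t := supF (fun i => a i - 2 * l (h i t)).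
apply: (@le_trans _ _ (\sum_t p t * \sum_t' p t' * ((Qp t' + Qm t) / 2))).
  apply: ler_sum => t _; rewrite ler_wpM2l//; apply: supF_le => i Fi.
  have -> : a i + (expl i - l (h i t)) =
      \sum_t' p t' * (a i + (l (h i t') - l (h i t))).
    under eq_bigr do rewrite addrA mulrBr mulrDr.
    by rewrite sumrB big_split /= -!big_distrl /= p1 !mul1r addrA.
  apply: ler_sum => t' _; rewrite ler_wpM2l//.
  have : a i + 2 * l (h i t') <= Qp t'.
    by apply: supF_ge => //; exact/bounded_onD/bounded_onZ/bounded_l.
  have : a i - 2 * l (h i t) <= Qm t.
    by apply: supF_ge => //; exact/bounded_onB/bounded_onZ/bounded_l.
  lra.
have -> : \sum_t p t * (\sum_t' p t' * ((Qp t' + Qm t) / 2)) =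
    \sum_t p t * ((Qp t + Qm t) / 2).
  have inner t : \sum_t' p t' * ((Qp t' + Qm t) / 2) =
      \sum_t' p t' * (Qp t' / 2) + Qm t / 2.
    rewrite -[in RHS](mul1r (Qm t / 2)) -p1 mulr_suml -big_split /=.
    by apply: eq_bigr => t' _; ring.
  under eq_bigr do rewrite inner mulrDr.
  rewrite big_split /= -mulr_suml p1 mul1r -big_split /=.
  by apply: eq_bigr => t _; ring.
by apply: ler_sum => t _; rewrite ler_wpM2l// ler_wpM2r// contraction1.
Qed.

Definition fair_coin (b : bool) : R := 2^-1.

(** Induction on the letters. The offset [a] is arbitrary so that it can absorb the deviation of the
    head while the tail is symmetrized, and then the signed sum of the tail while [symmetrization1]
    treats the head. *)
Lemma symmetrization n a : bounded_on a ->
  EE p n (fun u => supF (fun i => a i + \sum_(t <- u) (expl i - l (h i t)))) <=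
  EE p n (fun u => EE fair_coin n (fun e =>
    supF (fun i => a i + 2 * \sum_(q <- zip e u) sgn R q.1 * h i q.2))).
Proof.
elim: n a => [|n IH] a ba.
  by rewrite !EE0 /= (@supF_eq _ a) ?(@supF_eq _ a)// => i _;
     rewrite !big_nil ?mulr0 addr0.
rewrite EES; apply: (@le_trans _ _ (\sum_t p t * EE p n (fun u => EE fair_coin n (fun e =>
    supF (fun i => (a i + 2 * \sum_(q <- zip e u) sgn R q.1 * h i q.2) +
                   (expl i - l (h i t))))))).
  apply: ler_sum => t _; rewrite ler_wpM2l//.
  apply: le_trans (le_trans (IH (fun i => a i + (expl i - l (h i t))) _) _).
  - apply: EE_le => // u _; apply: supF_le => i Fi.
    rewrite big_cons addrA.
    apply: (@supF_ge (fun i => a i + _ + _)) => //.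
    apply: bounded_onD; first apply: bounded_onD => //.
      exact/bounded_onB/bounded_l/bounded_expl.
    by apply: bounded_on_sum => t'; exact/bounded_onB/bounded_l/bounded_expl.
  - by apply: bounded_onD => //; exact/bounded_onB/bounded_l/bounded_expl.
  - apply: EE_le => // u _; apply: EE_le => [b|e _]; first by rewrite invr_ge0.
    by rewrite le_eqVlt; apply/orP; left; apply/eqP/supF_eq => i _; ring.
under eq_bigr do rewrite -EEZ.
rewrite -EE_sum.
apply: (@le_trans _ _ (EE p n (fun u => EE fair_coin n (fun e => \sum_t p t *
   ((supF (fun i => a i + 2 * \sum_(q <- zip (true :: e) (t :: u)) sgn R q.1 * h i q.2) +
     supF (fun i => a i + 2 * \sum_(q <- zip (false :: e) (t :: u)) sgn R q.1 * h i q.2))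
    / 2))))).
  apply: EE_le => // u _.
  under eq_bigr do rewrite -EEZ.
  rewrite -EE_sum; apply: EE_le => [b|e _]; first by rewrite invr_ge0.
  apply: le_trans (symmetrization1 _) _.
    apply: bounded_onD => //; apply: bounded_onZ; apply: bounded_on_sum => q.
    exact/bounded_onZ/bounded_h.
  apply: ler_sum => t _; rewrite ler_wpM2l// ler_wpM2r//.
  rewrite le_eqVlt; apply/orP; left; apply/eqP; congr (_ + _);
    by apply: supF_eq => i _; rewrite /= big_cons /sgn /=; ring.
rewrite le_eqVlt; apply/orP; left; apply/eqP.
rewrite EES; under [RHS]eq_bigr do rewrite -EEZ.
rewrite -EE_sum; apply: EE_eq => u _.
rewrite EE_sum; apply: eq_bigr => t _.
rewrite EEZ EES big_bool /= -!EEZ -EED -EEZ.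
by apply: EE_eq => e _; rewrite /fair_coin; ring.
Qed.

(** [Q] says that the supremum [dev] exceeds its mean by at most [eps]. Symmetrization with offset
    [0] bounds the mean; changing one letter moves [dev] by at most [2 B], because [l] is
    1-Lipschitz and [h] is bounded by [B], so McDiarmid applies. *)
Lemma uniform_deviation n L : (0 < n)%N -> 0 < B -> 0 <= L ->
  exists Q : seq T -> bool, 1 - expR (- L) <= EE p n (fun u => (Q u)%:R) /\
    forall u i, Q u -> F i -> \sum_(t <- u) (expl i - l (h i t)) <=
      EE p n (fun u => EE fair_coin n (fun e =>
        supF (fun i => 2 * \sum_(q <- zip e u) sgn R q.1 * h i q.2))) +
      2 * B * Num.sqrt (2 * L * n%:R).
Proof.
move=> n0 B0 L0; set Rad := EE p n (fun u => EE fair_coin n _).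
set eps := 2 * B * _.
pose dev u := supF (fun i => \sum_(t <- u) (expl i - l (h i t))).
have bdev u : bounded_on (fun i => \sum_(t <- u) (expl i - l (h i t))).
  by apply: bounded_on_sum => t; exact/bounded_onB/bounded_l/bounded_expl.
have dev_Rad : EE p n dev <= Rad.
  have := symmetrization n (bounded_on_cst 0); congr (_ <= _).
    by apply: EE_eq => u _; apply: supF_eq => i _; rewrite add0r.
  by apply: EE_eq => u _; apply: EE_eq => e _; apply: supF_eq => i _; rewrite add0r.
have dev_le u v t t' : dev (u ++ t :: v) <= dev (u ++ t' :: v) + 2 * B.
  apply: supF_le => i Fi; rewrite -lerBlDr; apply: le_trans (supF_ge (bdev _) Fi).
  rewrite !big_cat !big_cons /=.
  have := le_trans (l_lip (h i t') (h i t)) (ler_normB _ _).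
  have := hB t Fi; have := hB t' Fi; move=> h1 h2 /ler_normlW; lra.
have bd : bounded_differences n dev (2 * B).
  by move=> u v t t' _; rewrite ler_distl; apply/andP; split;
    rewrite ?lerBlDr dev_le.
have := mcdiarmid p0 p1 n0 (mulr_gt0 (ltr0Sn R 1) B0) L0 bd.
set A := EE p n (fun u => _%:R); move=> AL.
exists (fun u => dev u <= EE p n dev + eps); split; last first.
  move=> u i devu Fi; apply: le_trans (supF_ge (bdev u) Fi) (le_trans devu _).
  by rewrite lerD2r.
apply: (@le_trans _ _ (1 - A)); first by rewrite lerD2l lerN2.
rewrite lerBlDr -[leLHS](EE_cst p1 n) -EED; apply: EE_le => // u _.
by rewrite -natrD; case: leP => _; rewrite ?addn0 ?add0n.
Qed.

End symmetrization.

(** * Matrix norms and their duals *)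

Lemma entry_le_mx_norm (R : realType) m n (A : 'M[R]_(m, n)) i j : `|A i j| <= `|A|.
Proof.
by rewrite [leRHS]/Num.norm /= mx_normrE; apply/bigmax_geP; right; exists (i, j).
Qed.

Section matrix_norm.
Variables (R : realType) (d : nat) (N : 'M[R]_d -> R).
Hypothesis normN : matrix_norm N.

Let N_eq0 A : N A = 0 -> A = 0. Proof. by case: normN => h _ _; exact: h. Qed.
Let N_Z a A : N (a *: A) = `|a| * N A.
Proof. by case: normN => _ h _; exact: h. Qed.
Let N_D A B : N (A + B) <= N A + N B. Proof. by case: normN => _ _ h; exact: h. Qed.

Lemma matrix_norm0 : N 0 = 0.
Proof. by rewrite -(scale0r (0 : 'M[R]_d)) N_Z normr0 mul0r. Qed.

Lemma matrix_normN A : N (- A) = N A.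
Proof. by rewrite -scaleN1r N_Z normrN normr1 mul1r. Qed.

Lemma matrix_norm_ge0 A : 0 <= N A.
Proof.
by have := N_D A (- A); rewrite subrr matrix_norm0 matrix_normN; lra.
Qed.

Lemma matrix_norm_sum (I : Type) (r : seq I) (B : I -> 'M[R]_d) :
  N (\sum_(i <- r) B i) <= \sum_(i <- r) N (B i).
Proof.
elim: r => [|i r IH]; first by rewrite !big_nil matrix_norm0.
by rewrite !big_cons (le_trans (N_D _ _))// lerD2l.
Qed.

Lemma matrix_norm_lipschitz (v : 'rV[R]_(d * d)) :
  N (vec_mx v) <= (\sum_k N (vec_mx (delta_mx 0 k))) * `|v|.
Proof.
rewrite {1}(row_sum_delta v) linear_sum (le_trans (matrix_norm_sum _ _))//.
rewrite mulr_suml; apply: ler_sum => k _; rewrite linearZ /= N_Z mulrC.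
rewrite ler_wpM2l ?matrix_norm_ge0//.
exact: entry_le_mx_norm.
Qed.

(* Equivalence of norms: N attains a positive minimum on the unit sphere of the sup norm. *)
Lemma entry_le_matrix_norm :
  exists2 c, 0 < c & forall (A : 'M[R]_d) i j, `|A i j| <= c * N A.
Proof.
pose f := fun v : 'rV[R]_(d * d) => N (vec_mx v).
pose K := \sum_k N (vec_mx (delta_mx 0 k : 'rV[R]_(d * d))).
pose S := [set v : 'rV[R]_(d * d) | `|v| = 1].
have fZ k v : f (k *: v) = `|k| * f v by rewrite /f linearZ /= N_Z.
have entry_le (A : 'M[R]_d) i j : `|A i j| <= `|mxvec A|.
  by rewrite -[A in leLHS](mxvecK A) mxE entry_le_mx_norm.
(* The sphere is empty only if every matrix vanishes ([d = 0]); any constant then works. *)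
have [S0|S0] := pselect (S !=set0); last first.
  exists 1 => // A i j; rewrite mul1r (le_trans (entry_le A i j))//.
  have [->|A0] := eqVneq (mxvec A) 0; first by rewrite normr0 matrix_norm_ge0.
  exfalso; apply: S0; exists (`|mxvec A|^-1 *: mxvec A).
  by rewrite /S /= normrZ normfV normr_id mulVf// normr_eq0.
have f_lip u v : `|f u - f v| <= K * `|u - v|.
  have half u' v' : f u' - f v' <= K * `|u' - v'|.
    rewrite lerBlDr -{1}(subrK v' u') (le_trans _ (lerD (matrix_norm_lipschitz _) (lexx _)))//.
    by rewrite /f linearD N_D.
  by rewrite ler_norml half andbT lerNl opprB distrC half.
have K0 : 0 <= K by apply: sumr_ge0 => k _; exact: matrix_norm_ge0.
have fc : continuous f.
  move=> u;
  apply/(@cvgrPdist_le _ _ _ (nbhs u) (nbhs_filter u)) => e e0.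
  have eK : 0 < e / (K + 1) by rewrite divr_gt0// ltr_wpDl.
  have h : \forall v \near u, `|u - v| <= e / (K + 1).
    by apply/nbhs_normP; exists (e / (K + 1)) => //= v /ltW.
  near=> v; have : `|u - v| <= e / (K + 1) by near: v.
  rewrite ler_pdivlMr ?ltr_wpDl// => uv.
  rewrite (le_trans (f_lip _ _))// (le_trans _ uv)// mulrC ler_wpM2l//; lra.
have cS : compact S.
  apply: bounded_closed_compact.
    by exists 1; split => // M M1 v /= ->; exact: ltW.
  rewrite (_ : S = (fun v => `|v|) @^-1` [set 1])//; apply: closed_comp => //.
    by move=> v _; exact: norm_continuous.
have [v0 /[!inE] Sv0 v0min] : exists2 c, c \in S & forall t, t \in S -> f c <= f t.
  by apply: EVT_min_rV => //; exact: continuous_subspaceT.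
have fv0 : 0 < f v0.
  rewrite lt_neqAle matrix_norm_ge0 andbT eq_sym; apply/eqP => /N_eq0 v00.
  by move: Sv0; rewrite /S /= -(vec_mxK v0) v00 linear0 normr0 => /esym/eqP; rewrite oner_eq0.
exists (f v0)^-1; first by rewrite invr_gt0.
move=> A i j; rewrite (le_trans (entry_le A i j))// mulrC ler_pdivlMr//.
have [->|A0] := eqVneq (mxvec A) 0; first by rewrite normr0 mul0r matrix_norm_ge0.
have A0' : 0 < `|mxvec A| by rewrite normr_gt0.
have := v0min (`|mxvec A|^-1 *: mxvec A).
rewrite inE /S /= normrZ normfV normr_id mulVf ?lt0r_neq0// => /(_ erefl).
by rewrite fZ normfV normr_id mulrC ler_pdivlMr// /f mxvecK mulrC.
Unshelve. all: by end_near. Qed.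

(** Apply the bound to [A] divided by its norm and to the opposite matrix. This turns dual norm
    bounds into bounds proportional to [N A]. *)
Lemma linear_le_matrix_norm (phi : 'M[R]_d -> R) v :
  (forall a A, phi (a *: A) = a * phi A) ->
  (forall A, N A <= 1 -> phi A <= v) -> forall A, `|phi A| <= v * N A.
Proof.
move=> phiZ phiv A.
have [NA0|NA0] := eqVneq (N A) 0.
  have -> : phi A = 0 by rewrite (N_eq0 NA0) -(scale0r (0 : 'M[R]_d)) phiZ mul0r.
  by rewrite NA0 mulr0 normr0.
have NA : 0 < N A by rewrite lt_def NA0 matrix_norm_ge0.
have NB : N ((N A)^-1 *: A) = 1 by rewrite N_Z normfV (gtr0_norm NA) mulVf.
have -> : phi A = N A * phi ((N A)^-1 *: A) by rewrite phiZ mulrA mulfV// mul1r.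
rewrite normrM (gtr0_norm NA) mulrC ler_pM2r// ler_norml phiv ?NB// andbT.
by rewrite lerNl -mulN1r -phiZ phiv// scaleN1r matrix_normN NB.
Qed.

Lemma trace_mul_le (B A : 'M[R]_d) (b a : R) :
  (forall i j, `|B i j| <= b) -> (forall i j, `|A i j| <= a) ->
  `|\tr (B^T *m A)| <= d%:R ^+ 2 * (b * a).
Proof.
move=> Bb Aa; rewrite (le_trans (ler_norm_sum _ _ _))//.
apply: (@le_trans _ _ (\sum_(i < d) \sum_(j < d) (b * a))); last first.
  by rewrite !sumr_const card_ord expr2 -mulrA !mulr_natl.
apply: ler_sum => i _; rewrite mxE (le_trans (ler_norm_sum _ _ _))//.
by apply: ler_sum => j _; rewrite mxE normrM ler_pM.
Qed.

(** Makes the [sup] in [dual_norm] a true supremum: by equivalence of norms the unit ball of [N] has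
    bounded entries. *)
Lemma dual_norm_ubound (B : 'M[R]_d) :
  has_ubound [set \tr (B^T *m A) | A in [set A : 'M[R]_d | N A <= 1]].
Proof.
have [c c0 cN] := entry_le_matrix_norm.
exists (d%:R ^+ 2 * ((\sum_i \sum_j `|B i j|) * c)) => _ [A /= NA <-].
rewrite (le_trans (ler_norm _))// trace_mul_le// => [i j|i j].
  rewrite (bigD1 i)//= (bigD1 j)//= -addrA lerDl addr_ge0// ?sumr_ge0// => *.
  exact: sumr_ge0.
by rewrite (le_trans (cN A i j))// -{2}[c]mulr1 ler_wpM2l// ltW.
Qed.

Lemma dual_norm_ge B A : N A <= 1 -> \tr (B^T *m A) <= dual_norm N B.
Proof.
by move=> NA; apply: ub_le_sup; [exact: dual_norm_ubound|exists A].
Qed.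

Lemma dual_norm_le B v : (forall A, N A <= 1 -> \tr (B^T *m A) <= v) ->
  dual_norm N B <= v.
Proof.
move=> Bv; apply: ge_sup; last by move=> _ [A NA <-]; exact: Bv.
by exists (\tr (B^T *m 0)); exists 0 => //=; rewrite matrix_norm0.
Qed.

End matrix_norm.

(** * The bilinear form [KA] as a trace pairing *)

Section bilinear.
Variables (R : realType) (d : nat).
Implicit Types (A : 'M[R]_d) (x y : 'cV[R]_d).

Lemma KA_trace A x y : \tr ((x *m y^T)^T *m A) = KA A x y.
Proof. by rewrite trmx_mul trmxK -mulmxA mxtrace_mulC trace_mx11. Qed.

Lemma KA_trace_sum (m : nat) (c : R) (k : 'I_m -> R) (x : 'I_m -> 'cV[R]_d) A y :
  \tr ((c *: \sum_(i < m) k i *: (x i *m y^T))^T *m A) =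
  c * \sum_(i < m) k i * KA A (x i) y.
Proof.
rewrite linearZ /= -scalemxAl mxtraceZ; congr (_ * _).
rewrite linear_sum /= mulmx_suml raddf_sum; apply: eq_bigr => i _.
by rewrite linearZ /= -scalemxAl mxtraceZ KA_trace.
Qed.

Lemma KA_sym A x y : sym_mx A -> KA A x y = KA A y x.
Proof.
rewrite /sym_mx /= /KA => symA.
by rewrite -[in LHS](trmxK (x^T *m A *m y)) mxE !trmx_mul trmxK symA mulmxA.
Qed.

Lemma KAZ a A x y : KA (a *: A) x y = a * KA A x y.
Proof. by rewrite /KA -scalemxAr -scalemxAl mxE. Qed.

Lemma KA_0 x y : KA 0 x y = 0 :> R.
Proof. by rewrite /KA mulmx0 mul0mx mxE. Qed.

Lemma KABl A x y z : KA A (x - y) z = KA A x z - KA A y z.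
Proof. by rewrite /KA linearB /= !mulmxBl !mxE. Qed.

Lemma KABr A x y z : KA A x (y - z) = KA A x y - KA A x z.
Proof. by rewrite /KA mulmxBr !mxE. Qed.

Lemma KA_le A x y a b b' : (forall i j, `|A i j| <= a) ->
  (forall i, `|x i 0| <= b) -> (forall i, `|y i 0| <= b') ->
  `|KA A x y| <= d%:R ^+ 2 * (b * b' * a).
Proof.
move=> Aa xb yb; rewrite -KA_trace; apply: trace_mul_le => // i j.
by rewrite mxE big_ord_recl big_ord0 addr0 mxE normrM ler_pM.
Qed.

End bilinear.

(** * The hypothesis class *)

Lemma hinge_ge0 (R : realType) (t : R) : 0 <= hinge t.
Proof. by rewrite le_max lexx. Qed.

Lemma hinge_lip (R : realType) (s t : R) : `|hinge s - hinge t| <= `|s - t|.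
Proof.
rewrite /hinge !maxEle; case: (leP 0 s) => s0; case: (leP 0 t) => t0 //.
- by rewrite subr0 ger0_norm// (le_trans _ (ler_norm _))//; lra.
- by rewrite sub0r normrN ger0_norm// distrC (le_trans _ (ler_norm _))//; lra.
- by rewrite subrr normr0.
Qed.

Section hypothesis_class.
Variables (R : realType) (d m : nat) (N : 'M[R]_d -> R) (X : set 'cV[R]_d).
Hypotheses (m0 : (0 < m)%N) (normN : matrix_norm N) (X0 : X !=set0).
Variables (M c : R).
Hypotheses (M0 : 0 <= M) (XM : forall x, X x -> forall i, `|x i 0| <= M).
Hypotheses (c0 : 0 < c) (cN : forall (A : 'M[R]_d) i j, `|A i j| <= c * N A).

Lemma dual_norm_le_Xstar x y : X x -> X y -> dual_norm N (y *m x^T) <= Xstar N X.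
Proof.
move=> Xx Xy; apply: ub_le_sup; last by exists (x, y).
exists (d%:R ^+ 2 * (M * M * c)) => _ [[u v] [/= Xu Xv] <-].
apply: dual_norm_le => // C NC; rewrite (le_trans (ler_norm _))// KA_trace.
apply: KA_le; [|exact: XM|exact: XM] => i j.
by rewrite (le_trans (cN C i j))// -[leRHS]mulr1 ler_wpM2l// ltW.
Qed.

Lemma Xstar_ge x y A : X x -> X y -> `|KA A x y| <= Xstar N X * N A.
Proof.
move=> Xx Xy; apply: (linear_le_matrix_norm normN (phi := fun A => KA A x y)).
  by move=> a B; exact: KAZ.
move=> B NB; rewrite -KA_trace (le_trans (dual_norm_ge normN _ NB))//.
exact: dual_norm_le_Xstar.
Qed.

Lemma Xstar_ge0 : 0 <= Xstar N X.
Proof.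
case: X0 => x Xx; apply: le_trans (dual_norm_le_Xstar Xx Xx).
have N01 : N 0 <= 1 by rewrite (matrix_norm0 normN).
by apply: le_trans (dual_norm_ge normN _ N01); rewrite mulmx0 mxtrace0.
Qed.

Definition labelled : set (Zt R d) := [set z | X (vec z.1) /\ (z.2 = 1 \/ z.2 = -1)].

Definition eta_close (eta : R) (z z' : Zt R d) :=
  z.2 = z'.2 /\ forall j, `|vec z.1 j 0 - vec z'.1 j 0| <= eta.

Lemma label_norm z : labelled z -> `|z.2| = 1.
Proof. by move=> [_ [->|->]]; rewrite ?normrN normr1. Qed.

Lemma sgn_norm b : `|sgn R b| = 1.
Proof. by case: b; rewrite /sgn ?normrN normr1. Qed.

(** * Rademacher suprema of labelled samples *)

Section rademacher_sup.
Implicit Types (s : 'I_m -> Zt R d) (sigma : {ffun 'I_m -> bool}).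

(** The pairing in [KA_trace_sum] is one of those defining the dual norm. What needs proof is that
    the supremum is finite, which follows from the entry bounds [M] on points and [c] on the unit
    ball. *)
Lemma rad_sup_ge s sigma A x : (forall i, labelled (s i)) -> N A <= 1 -> X x ->
  m%:R^-1 * \sum_(i < m) sgn R (sigma i) * ys s i * KA A (xs s i) x
    <= rad_sup N X s sigma.
Proof.
move=> Ds NA Xx; rewrite -KA_trace_sum (le_trans (dual_norm_ge normN _ NA))//.
apply: ub_le_sup; last by exists x.
exists (m%:R^-1 * \sum_(i < m) d%:R ^+ 2 * (M * M * c)) => _ [y /= Xy <-].
apply: dual_norm_le => // B NB; rewrite KA_trace_sum ler_wpM2l ?invr_ge0//.
apply: ler_sum => i _; rewrite (le_trans (ler_norm _))// !normrM sgn_norm.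
rewrite label_norm// !mul1r; apply: KA_le; [|apply: XM|exact: XM].
  by move=> j k; rewrite (le_trans (cN B j k))// -[leRHS]mulr1 ler_wpM2l// ltW.
by case: (Ds i).
Qed.

Lemma rad_sup_le s sigma v : (forall A x, N A <= 1 -> X x ->
  m%:R^-1 * \sum_(i < m) sgn R (sigma i) * ys s i * KA A (xs s i) x <= v) ->
  rad_sup N X s sigma <= v.
Proof.
move=> h; apply: ge_sup.
  by case: X0 => x Xx; eexists; exists x.
by move=> _ [x Xx <-]; apply: dual_norm_le => // A NA; rewrite KA_trace_sum h.
Qed.

Lemma rad_sup_ge0 s sigma : (forall i, labelled (s i)) -> 0 <= rad_sup N X s sigma.
Proof.
move=> Ds; case: X0 => x Xx.
have := @rad_sup_ge s sigma 0 x Ds; rewrite (matrix_norm0 normN) => /(_ ler01 Xx).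
by rewrite big1 ?mulr0// => i _; rewrite KA_0 mulr0.
Qed.

Lemma rad_sup_sum s sigma A x : (forall i, labelled (s i)) -> X x ->
  `|\sum_(i < m) sgn R (sigma i) * ys s i * KA A (xs s i) x|
    <= m%:R * rad_sup N X s sigma * N A.
Proof.
move=> Ds Xx.
apply: (linear_le_matrix_norm normN
  (phi := fun A => \sum_(i < m) sgn R (sigma i) * ys s i * KA A (xs s i) x)).
  by move=> a B; rewrite mulr_sumr; apply: eq_bigr => i _; rewrite KAZ mulrCA.
by move=> B NB; rewrite -ler_pdivrMl ?ltr0n// rad_sup_ge.
Qed.

(** Uniformly in [A] and [x], moving the points by [eta] in each coordinate with labels fixed
    changes each term [KA A (xs s i) x] by at most the added constant. *)
Lemma rad_sup_close eta s s' sigma :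
  (forall i, labelled (s i)) -> (forall i, labelled (s' i)) ->
  (forall i, eta_close eta (s i) (s' i)) ->
  rad_sup N X s sigma <= rad_sup N X s' sigma + d%:R ^+ 2 * (eta * M * c).
Proof.
move=> Ds Ds' ss'; apply: rad_sup_le => A x NA Xx.
rewrite -lerBlDr (le_trans _ (@rad_sup_ge s' sigma A x Ds' NA Xx))// lerBlDr.
have -> : d%:R ^+ 2 * (eta * M * c) =
    m%:R^-1 * \sum_(i < m) d%:R ^+ 2 * (eta * M * c).
  by rewrite sumr_const card_ord -(mulr_natl (_ * _)) mulKf// pnatr_eq0 -lt0n.
rewrite -mulrDr ler_wpM2l ?invr_ge0// -big_split /=.
apply: ler_sum => i _; rewrite -lerBlDl.
have [yE xE] := ss' i.
rewrite {1}/ys yE -/(ys s' i) -mulrBr -KABl (le_trans (ler_norm _))//.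
rewrite !normrM sgn_norm label_norm// !mul1r; apply: KA_le; last exact: XM.
  by move=> j k; rewrite (le_trans (cN A j k))// -[leRHS]mulr1 ler_wpM2l// ltW.
by move=> j; rewrite mxE [X in _ + X]mxE.
Qed.

End rademacher_sup.

Variables (r lambda : R).
Hypotheses (r0 : 0 < r) (lambda0 : 0 < lambda).

Definition kernel_class : set ('cV[R]_d -> R) :=
  [set f | exists A (beta : 'I_m -> R) (xt : 'I_m -> 'cV[R]_d),
     [/\ sym_mx A, N A <= lambda^-1, \sum_(j < m) `|beta j| <= r^-1,
         forall j, X (xt j) & f = fun x => \sum_(j < m) beta j * KA A (xt j) x]].

Lemma weighted_sum_le (beta k : 'I_m -> R) v : \sum_(j < m) `|beta j| <= r^-1 ->
  0 <= v -> (forall j, `|k j| <= v) -> `|\sum_(j < m) beta j * k j| <= v / r.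
Proof.
move=> b v0 kv; rewrite (le_trans (ler_norm_sum _ _ _))//.
apply: (@le_trans _ _ ((\sum_(j < m) `|beta j|) * v)).
  by rewrite mulr_suml; apply: ler_sum => j _; rewrite normrM ler_wpM2l.
by rewrite mulrC ler_wpM2l.
Qed.

Lemma kernel_class_bound f x : kernel_class f -> X x ->
  `|f x| <= Xstar N X / (lambda * r).
Proof.
move=> [A [beta [xt [sA NA bb Xt ->]]]] Xx.
rewrite invfM mulrA; apply: weighted_sum_le => // [|j].
  by rewrite divr_ge0 ?Xstar_ge0 ?ltW.
by rewrite (le_trans (Xstar_ge _ _ _))// ler_wpM2l// Xstar_ge0.
Qed.

Lemma kernel_class_lip (eta : R) f (x y : 'cV[R]_d) : 0 <= eta -> kernel_class f ->
  (forall j, `|x j 0 - y j 0| <= eta) ->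
  `|f x - f y| <= d%:R ^+ 2 * (M * eta * c) / (lambda * r).
Proof.
move=> eta0 [A [beta [xt [sA NA bb Xt ->]]]] xy.
set K := (d%:R ^+ 2 * _).
rewrite -sumrB invfM mulrA; under eq_bigr do rewrite -mulrBr -KABr.
apply: weighted_sum_le => // [|j].
  by rewrite divr_ge0 ?(ltW lambda0)// /K !mulr_ge0// ltW.
have -> : K / lambda = d%:R ^+ 2 * (M * eta * (c / lambda)) by rewrite /K; ring.
apply: KA_le => [i k|i|i]; last 2 first.
- exact: XM.
- by rewrite mxE [X in _ + X]mxE.
by rewrite (le_trans (cN A i k))// ler_wpM2l// ltW.
Qed.

(** After exchanging the sums, the symmetry of [A] moves [xt j] to the right argument of [KA], where
    it becomes the point over which [rad_sup] takes its supremum. The weights contribute [1 / r],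
    the norm of [A] contributes [1 / lambda]. *)
Lemma kernel_class_rad f (s : 'I_m -> Zt R d) (sigma : {ffun 'I_m -> bool}) :
  kernel_class f -> (forall i, labelled (s i)) ->
  \sum_(i < m) sgn R (sigma i) * (ys s i * f (xs s i)) <=
  m%:R * rad_sup N X s sigma / (lambda * r).
Proof.
move=> [A [beta [xt [sA NA bb Xt ->]]]] Ds; apply: le_trans (ler_norm _) _.
have -> : \sum_(i < m) sgn R (sigma i) *
      (ys s i * \sum_(j < m) beta j * KA A (xt j) (xs s i)) =
    \sum_(j < m) beta j * \sum_(i < m) sgn R (sigma i) * ys s i * KA A (xs s i) (xt j).
  under eq_bigr do rewrite mulrA mulr_sumr.
  rewrite exchange_big; apply: eq_bigr => j _; rewrite mulr_sumr.
  by apply: eq_bigr => i _; rewrite (KA_sym _ _ sA) mulrCA.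
rewrite invfM mulrA; apply: weighted_sum_le => // [|j].
  by rewrite divr_ge0 ?(ltW lambda0)// mulr_ge0// rad_sup_ge0.
by rewrite (le_trans (rad_sup_sum _ _ _ _))// ler_wpM2l// mulr_ge0 ?rad_sup_ge0.
Qed.

Lemma emp_err_ge0 (s : 'I_m -> Zt R d) A : 0 <= emp_err r s A.
Proof.
by rewrite mulr_ge0 ?invr_ge0// sumr_ge0// => i _; exact: hinge_ge0.
Qed.

Lemma emp_err0 (s : 'I_m -> Zt R d) : emp_err r s 0 = 1.
Proof.
rewrite /emp_err (eq_bigr (fun=> 1)) => [|i _].
  by rewrite sumr_const card_ord mulVf// pnatr_eq0 -lt0n.
rewrite big1 ?mulr0 ?subr0 /hinge; last by move=> j _; rewrite KA_0 mulr0.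
by apply/max_idPr.
Qed.

Lemma minimizer_norm_le (s : 'I_m -> Zt R d) A :
  emp_err r s A + lambda * N A <= emp_err r s 0 + lambda * N 0 ->
  N A <= lambda^-1.
Proof.
rewrite emp_err0 (matrix_norm0 normN) mulr0 addr0 => h.
rewrite -[leRHS]mulr1 ler_pdivlMl//; have := emp_err_ge0 s A; lra.
Qed.

Lemma emp_hinge_le (s : 'I_m -> Zt R d) A (alpha : 'I_m -> R) : sym_mx A ->
  (forall i, labelled (s i)) ->
  (forall beta : 'I_m -> R, \sum_(j < m) `|beta j| <= r^-1 ->
     emp_hinge s (fA s A alpha) <= emp_hinge s (fA s A beta)) ->
  emp_hinge s (fA s A alpha) <= emp_err r s A.
Proof.
move=> sA Ds h; have mr0 : m%:R * r != 0 by rewrite mulf_neq0 ?pnatr_eq0 -?lt0n// gt_eqF.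
(* Since labels have absolute value [1], these weights have absolute sum exactly [1 / r]; their
   expansion reproduces the inner sum of [emp_err]. *)
apply: le_trans (h (fun j => (m%:R * r)^-1 * ys s j) _) _.
  under eq_bigr do rewrite normrM label_norm// mulr1.
  rewrite sumr_const card_ord ger0_norm ?invr_ge0 ?mulr_ge0 ?(ltW r0)//.
  by rewrite -(mulr_natl (_ ^-1)) invfM mulrA mulfV ?mul1r// pnatr_eq0 -lt0n.
rewrite le_eqVlt; apply/orP; left; apply/eqP; congr (_ * _).
apply: eq_bigr => i _; congr (hinge (1 - _)).
rewrite /fA !mulr_sumr; apply: eq_bigr => j _.
by rewrite (KA_sym (xs s i) (xs s j) sA); ring.
Qed.

End hypothesis_class.

(** * Discretization of the sample space *)

(** The integrand is a finite combination of indicators of cells. Extended real values are allowed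
    because [gen_err_le] assigns [+oo] to some null cells. *)
Lemma integral_finite_range d (Y : measurableType d) (R : realType)
    (mu : {measure set Y -> \bar R}) (T : finType) (c : Y -> T) (G : T -> \bar R) :
  (forall t, measurable (c @^-1` [set t])) -> (forall t, (0 <= G t)%E) ->
  (\int[mu]_y G (c y) = \sum_t G t * mu (c @^-1` [set t]))%E.
Proof.
move=> mc G0; pose ind t y := (\1_(c @^-1` [set t]) y)%:E : \bar R.
have ind0 t y : (0 <= ind t y)%E by rewrite lee_fin.
have mind t : measurable_fun [set: Y] (ind t : Y -> \bar R).
  by apply/measurable_EFinP; exact: measurable_indic.
transitivity (\int[mu]_y \sum_t (G t * ind t y))%E.
  apply: eq_integral => y _; rewrite (bigD1 (c y))//= big1 => [|t tc].
    by rewrite /ind indicE mem_set// mule1 adde0.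
  rewrite /ind indicE memNset ?mule0// => /= E; by rewrite E eqxx in tc.
rewrite ge0_integral_sum//; last 2 first.
- by move=> t; exact: measurable_funeM.
- by move=> t y _; rewrite mule_ge0.
apply: eq_bigr => t _; rewrite ge0_integralZl//.
by rewrite integral_indic// setIT.
Qed.

(* [g] need not be measurable, which is why [ge0_le_integral] is not used. *)
Lemma ge0_le_integralT d (Y : measurableType d) (R : realType)
    (mu : {measure set Y -> \bar R}) (f g : Y -> \bar R) :
  (forall y, (0 <= f y)%E) -> (forall y, (f y <= g y)%E) ->
  (\int[mu]_y f y <= \int[mu]_y g y)%E.
Proof.
move=> f0 fg; have g0 y : (0 <= g y)%E by exact: le_trans (f0 y) (fg y).
rewrite !ge0_integralTE//; apply: ub_ereal_sup => _ [h hf <-].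
by apply: ereal_sup_ubound; exists h => // y; exact: le_trans (hf y) (fg y).
Qed.

(** * Law of the word of cells of the sample *)

Section cells.
Variables (R : realType) (d m : nat) (d0 : measure_display).
Variables (Omega : measurableType d0) (P : probability Omega R).
Variables (Zs : 'I_m -> Omega -> Zt R d) (rho : probability (Zt R d) R).
Hypothesis iid : iid_sample P Zs rho.
Variables (T : finType) (c : Zt R d -> T).
Hypothesis mc : forall t, measurable (c @^-1` [set t]).

Definition cell_prob t : R := fine (rho (c @^-1` [set t])).

Definition cell_seq w : m.-tuple T := [tuple c (Zs i w) | i < m].

Lemma cell_prob_ge0 t : 0 <= cell_prob t.
Proof. exact: fine_ge0. Qed.

Lemma cell_probE t : rho (c @^-1` [set t]) = (cell_prob t)%:E.
Proof. by rewrite fineK// fin_num_measure. Qed.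

Lemma cell_prob_sum : \sum_t cell_prob t = 1.
Proof.
apply: EFin_inj; rewrite -sumEFin.
have := @integral_finite_range _ _ _ rho _ c (fun=> 1%E) mc (fun=> lee01).
rewrite integral_cst//= mul1e probability_setT => ->.
by apply: eq_bigr => t _; rewrite mul1e cell_probE.
Qed.

Lemma cell_seq_preimage (u : m.-tuple T) : cell_seq @^-1` [set u] =
  \bigcap_(i in [set: 'I_m]) (Zs i @^-1` (c @^-1` [set tnth u i])).
Proof.
rewrite predeqE => w; split => [/= <- i _ /=|h /=]; first by rewrite tnth_mktuple.
by apply: eq_from_tnth => i; rewrite tnth_mktuple; exact: (h i Logic.I).
Qed.

Lemma measurable_cell_seq u : measurable (cell_seq @^-1` [set u]).
Proof.
have [mZ _ _] := iid; rewrite cell_seq_preimage.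
apply: fin_bigcap_measurable => [|i _]; first exact: finite_finset.
by rewrite -[X in measurable X]setTI; exact: mZ.
Qed.

Lemma cell_seq_prob u :
  P (cell_seq @^-1` [set u]) = (\prod_(i < m) cell_prob (tnth u i))%:E.
Proof.
have [mZ law indep] := iid; rewrite cell_seq_preimage indep//.
by congr (_%:E); apply: eq_bigr => i _; rewrite law.
Qed.

(** Carries expectations on the finite product space over to [Omega]: by independence the word of
    cells has the product law. *)
Lemma integral_cell_seq (G : seq T -> R) : (forall u, 0 <= G u) ->
  (\int[P]_w (G (cell_seq w))%:E = (EE cell_prob m G)%:E)%E.
Proof.
move=> G0; rewrite (@integral_finite_range _ _ _ P _ cell_seq (fun u => (G u)%:E)).
- rewrite -sumEFin; apply: eq_bigr => u _.
  by rewrite mulrC EFinM; congr (_ * _)%E; exact: cell_seq_prob.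
- exact: measurable_cell_seq.
- by move=> u; rewrite lee_fin.
Qed.

Lemma measurable_cell_event (Q : seq T -> bool) : measurable [set w | Q (cell_seq w)].
Proof.
rewrite (_ : [set w | _] =
    \bigcup_(u in [set u : m.-tuple T | Q u]) cell_seq @^-1` [set u]).
  apply: fin_bigcup_measurable => [|u _]; first exact: finite_finset.
  exact: measurable_cell_seq.
rewrite predeqE => w; split => [Qw|[u Qu E]]; last first.
  by suff : Q (cell_seq w) by []; rewrite (E : cell_seq w = u).
by exists (cell_seq w).
Qed.

Lemma cell_event_prob (Q : seq T -> bool) :
  P [set w | Q (cell_seq w)] = (EE cell_prob m (fun u => (Q u)%:R))%:E.
Proof.
rewrite -integral_cell_seq => [|u]; last exact: ler0n.
rewrite -[X in P X]setIT -(integral_indic P measurableT (measurable_cell_event Q)).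
apply: eq_integral => w _; rewrite indicE; congr ((nat_of_bool _)%:R%:E).
by apply/idP/idP => [/set_mem|/mem_set].
Qed.

End cells.

(** * A measurable grid of small cells *)

Section grid.
Variables (R : realType) (d : nat) (X : set 'cV[R]_d) (M : R).
Hypothesis XM : forall x, X x -> forall i, `|x i 0| <= M.

Lemma measurable_ffun_bool (J : finType) d' (Y : measurableType d') (test : J -> Y -> bool) :
  (forall j, measurable_fun setT (test j)) ->
  forall t : {ffun J -> bool},
    measurable ((fun y => [ffun j => test j y]) @^-1` [set t]).
Proof.
move=> mt t; rewrite (_ : _ @^-1` _ =
    \bigcap_(j in [set: J]) (test j @^-1` [set t j])).
  apply: fin_bigcap_measurable => [|j _]; first exact: finite_finset.
  by rewrite -[X in measurable X]setTI; exact: mt.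
rewrite predeqE => y; split => [/= <- j _|h] /=; first by rewrite ffunE.
by apply/ffunP => j; rewrite ffunE; exact: (h j Logic.I).
Qed.

(* [z'] may lie outside the support: the cells meeting the support are bounded. *)
Lemma exists_cells (eta : R) : 0 < eta -> exists (T : finType) (c : Zt R d -> T),
  (forall t, measurable (c @^-1` [set t])) /\
  (forall z z', labelled X z -> c z = c z' -> eta_close eta z z').
Proof.
(* A cell is a vector of answers to finitely many tests, on thresholds [- M + k eta] and on labels.
   The [+2] keeps the upper threshold [k.+1] of the last interval in range. *)
move=> eta0; pose K := (Num.truncn ((M + M) / eta)).+2.
pose test (j : 'I_d * 'I_K + bool) (z : Zt R d) : bool := match j with
  | inl (i, k) => (tnth z.1 i < - M + k%:R * eta)%R
  | inr b => z.2 == sgn R b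
  end.
exists {ffun 'I_d * 'I_K + bool -> bool}, (fun z => [ffun j => test j z]); split.
  apply: measurable_ffun_bool => -[[i k]|b] /=.
    apply: measurable_fun_ltr => //.
    by apply: (measurableT_comp (measurable_tnth i)); exact: measurable_fst.
  by apply: measurable_fun_eqr => //; exact: measurable_snd.
move=> z z' [Xz yz] /ffunP E.
have testE j : test j z = test j z' by have := E j; rewrite !ffunE.
split.
  case: yz => yz; [have := testE (inr true)|have := testE (inr false)];
    by rewrite /= /sgn yz eqxx => /esym/eqP ->.
move=> i; rewrite /vec !mxE; have := XM Xz i; rewrite /vec mxE ler_norml => /andP[x1 x2].
(* [x] lies between thresholds [k] and [k.+1]; equal answers to these two tests put the coordinate
   of [z'] in the same interval. *)
set x := tnth z.1 i in x1 x2 *; pose k := Num.truncn ((x + M) / eta).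
have xM0 : 0 <= (x + M) / eta by rewrite divr_ge0 ?(ltW eta0)//; lra.
have /andP[k1 k2] := Num.Theory.truncn_itv xM0; rewrite -/k in k1 k2.
rewrite ler_pdivlMr// in k1; rewrite ltr_pdivrMr// in k2.
have kK : (k.+1 < K)%N.
  rewrite !ltnS; apply: Num.Theory.le_truncn.
  by rewrite ler_pM2r ?invr_gt0//; lra.
have := testE (inl (i, Ordinal kK)); have := testE (inl (i, Ordinal (ltnW kK))).
rewrite /= -/x.
have -> : (x < - M + k%:R * eta) = false by apply/negbTE; rewrite -leNgt; lra.
have -> : (x < - M + k.+1%:R * eta) by lra.
move=> /esym/negbT; rewrite -leNgt => k3 /esym k4.
move: k2 k4; rewrite -natr1 => k2 k4.
rewrite ler_norml; lra.
Qed.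

End grid.

(** * The generalization bound *)

Lemma EE_fair_coin (R : realType) n (f : seq bool -> R) :
  EE (@fair_coin R) n f =
  (2 ^ n)%:R^-1 * \sum_(sigma : {ffun 'I_n -> bool}) f [tuple sigma i | i < n].
Proof.
rewrite /EE; under eq_bigr do rewrite /fair_coin prodr_const card_ord exprVn -natrX.
rewrite -mulr_sumr; congr (_ * _).
apply: (reindex (fun sigma : {ffun 'I_n -> bool} => [tuple sigma i | i < n])).
exists (fun e => [ffun i => tnth e i]) => [sigma _|e _].
  by apply/ffunP => i; rewrite ffunE tnth_mktuple.
by apply: eq_from_tnth => i; rewrite tnth_mktuple ffunE.
Qed.

Lemma sum_zip_tuple (R : realType) (S T : Type) n (e : n.-tuple S) (u : n.-tuple T)
    (F : S * T -> R) :
  \sum_(q <- zip e u) F q = \sum_(i < n) F (tnth e i, tnth u i).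
Proof.
have -> : zip e u = zip_tuple e u by [].
rewrite big_tuple; apply: eq_bigr => i _; congr F.
by rewrite (tnth_nth (tnth e i, tnth u i)) /= nth_zip ?size_tuple// -!tnth_nth.
Qed.

Section approximation.
Variables (R : realType) (d m : nat) (X : set 'cV[R]_d).
Variables (rho : probability (Zt R d) R).
Variables (d0 : measure_display) (Omega : measurableType d0).
Variables (P : probability Omega R) (Zs : 'I_m -> Omega -> Zt R d).
Variables (r lambda : R) (N : 'M[R]_d -> R).
Hypotheses (m0 : (0 < m)%N) (iid : iid_sample P Zs rho).
Hypothesis ZsD : forall i w, labelled X (Zs i w).
Hypotheses (r0 : 0 < r) (lambda0 : 0 < lambda) (normN : matrix_norm N).
Hypothesis X0 : X !=set0.
Variables (M c0 : R).
Hypotheses (M0 : 0 <= M) (XM : forall x, X x -> forall i, `|x i 0| <= M).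
Hypotheses (c0_gt0 : 0 < c0) (c0N : forall (A : 'M[R]_d) i j, `|A i j| <= c0 * N A).

(** The first sample point has law [rho] and always lies in [labelled X]. *)
Lemma law_null (B : set (Zt R d)) : measurable B ->
  (forall z, labelled X z -> ~ B z) -> rho B = 0%E.
Proof.
move=> mB BX; have [_ law _] := iid.
rewrite -(law (Ordinal m0) B mB) (_ : _ @^-1` B = set0) ?measure0//.
by rewrite -subset0 => w /= /BX; apply; exact: ZsD.
Qed.

Lemma kernel_class_nonempty : kernel_class m N X r lambda !=set0.
Proof.
case: X0 => x Xx; exists (fun x' => \sum_(j < m) 0 * KA 0 x x').
exists 0, (fun=> 0), (fun=> x); split => //.
- by rewrite /sym_mx /= trmx0.
- by rewrite (matrix_norm0 normN) invr_ge0 ltW.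
- by rewrite big1 ?invr_ge0 ?(ltW r0)// => j _; rewrite normr0.
Qed.

(** Bounds the variation of [rad_sup] per unit displacement of the sample; divided by [lambda r] it
    does so for the functions of [kernel_class]. *)
Definition lip_const : R := d%:R ^+ 2 * (M * c0).

Let K := lip_const / (lambda * r).

(** * Estimates for a fixed partition into cells *)

Section fixed_cells.
Variables (eta : R) (T : finType) (c : Zt R d -> T).
Hypothesis eta0 : 0 < eta.
Hypothesis mc : forall t, measurable (c @^-1` [set t]).
Hypothesis c_close : forall z z', labelled X z -> c z = c z' -> eta_close eta z z'.
Variables (rep : T -> Zt R d).
Hypothesis repD : forall t, labelled X (rep t).
Hypothesis c_rep : forall z, labelled X z -> c (rep (c z)) = c z.

Let p := cell_prob rho c.
Let l := fun a : R => hinge (1 - a).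
Let h := fun (f : 'cV[R]_d -> R) t => (rep t).2 * f (vec (rep t).1).
Let F := kernel_class m N X r lambda.
(** The summand [eta] makes [B] positive even when [Xstar N X] is [0], as [uniform_deviation]
    requires. *)
Let B := Xstar N X / (lambda * r) + eta.
Let U := cell_seq Zs c.

Lemma loss_lip a b : `|l a - l b| <= `|a - b|.
Proof.
rewrite /l (le_trans (hinge_lip _ _))// le_eqVlt; apply/orP; left; apply/eqP.
by rewrite -normrN; congr (`| _ |); ring.
Qed.

Lemma rep_bound f t : F f -> `|h f t| <= B.
Proof.
move=> Ff; rewrite /h normrM (label_norm (repD t)) mul1r.
apply: le_trans (kernel_class_bound normN X0 XM c0_gt0 c0N lambda0 Ff _) _.
  by case: (repD t).
by rewrite lerDl ltW.
Qed.

Lemma rep_loss_close f z : F f -> c (rep (c z)) = c z ->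
  `|l (z.2 * f (vec z.1)) - l (h f (c z))| <= K * eta.
Proof.
move=> Ff cz; have [yE xE] := c_close (repD _) cz.
rewrite (le_trans (loss_lip _ _))// /h -yE -mulrBr normrM (label_norm (repD _)) mul1r.
rewrite distrC (le_trans (kernel_class_lip M0 XM c0_gt0 c0N lambda0 (ltW eta0) Ff xE))//.
rewrite le_eqVlt; apply/orP; left; apply/eqP; rewrite /K /lip_const; ring.
Qed.

(** Dominating the loss by a function constant on cells turns the integral into a finite sum over
    cells. *)
Lemma gen_err_le f : F f ->
  (gen_err rho f <= (expl p l h f + K * eta)%:E)%E.
Proof.
move=> Ff.
(* Cells that miss the support have measure 0, hence may be given the value [+oo]. *)
pose G t : \bar R := if c (rep t) == t then (l (h f t) + K * eta)%:E else +oo%E.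
have K0 : 0 <= K * eta.
  by rewrite /K /lip_const !mulr_ge0 ?invr_ge0 ?mulr_ge0 ?(ltW lambda0) ?(ltW r0)
    ?(ltW c0_gt0) ?(ltW eta0)// exprn_ge0.
have G0 t : (0 <= G t)%E.
  by rewrite /G; case: ifP => // _; rewrite lee_fin addr_ge0// hinge_ge0.
apply: (@le_trans _ _ (\int[rho]_z G (c z))%E).
  apply: ge0_le_integralT => z; first by rewrite lee_fin hinge_ge0.
  rewrite /G; case: eqP => [cz|_]; last exact: leey.
  have := rep_loss_close Ff cz; rewrite lee_fin => /ler_normlW.
  by rewrite lerBlDr addrC.
rewrite (@integral_finite_range _ _ _ rho)//.
rewrite (eq_bigr (fun t => (p t * (l (h f t) + K * eta))%:E)).
  rewrite sumEFin lee_fin /expl.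
  under eq_bigr do rewrite mulrDr.
  by rewrite big_split /= -mulr_suml cell_prob_sum// mul1r.
move=> t _; transitivity (G t * (p t)%:E)%E.
  by congr (_ * _)%E; exact: cell_probE.
rewrite EFinM muleC /G; case: eqP => // cz.
suff -> : p t = 0 by rewrite !mul0e.
rewrite /p /cell_prob law_null// => z Dz /= zt; apply: cz.
by rewrite -zt; exact: c_rep.
Qed.

Lemma emp_hinge_ge f w : F f ->
  m%:R^-1 * \sum_(t <- U w) l (h f t) <= emp_hinge (sample Zs w) f + K * eta.
Proof.
move=> Ff; rewrite /emp_hinge big_tuple.
have -> : K * eta = m%:R^-1 * \sum_(i < m) K * eta.
  by rewrite sumr_const card_ord -(mulr_natl (_ * _)) mulKf// pnatr_eq0 -lt0n.
rewrite -mulrDr ler_wpM2l ?invr_ge0// -big_split /=; apply: ler_sum => i _.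
rewrite /U tnth_mktuple -lerBlDl.
have := rep_loss_close Ff (c_rep (ZsD i w)); rewrite distrC => /ler_normlW.
by [].
Qed.

(** Default value of [nth], reached only on words shorter than [m]. *)
Let t0 := c (rep (c (point : Zt R d))).

Definition cell_rad u : R := (2 ^ m)%:R^-1 *
  \sum_(sigma : {ffun 'I_m -> bool}) rad_sup N X (fun i => rep (nth t0 u i)) sigma.

Lemma cell_rad_tuple (u : m.-tuple T) : cell_rad u = (2 ^ m)%:R^-1 *
  \sum_(sigma : {ffun 'I_m -> bool}) rad_sup N X (fun i => rep (tnth u i)) sigma.
Proof.
rewrite /cell_rad.
have -> // : (fun i : 'I_m => rep (nth t0 u i)) = fun i => rep (tnth u i).
by apply/funext => i; rewrite (tnth_nth t0).
Qed.

(** Replacing the sample by the representatives of its cells changes each [rad_sup] by at most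
    [lip_const * eta]. *)
Lemma rademacher_ge :
  ((EE p m cell_rad - lip_const * eta)%:E <= rademacher P Zs N X)%E.
Proof.
(* The maximum with [0] makes the integrand nonnegative, and it stays below the Rademacher average,
   which is itself nonnegative. *)
pose G u := Num.max 0 (cell_rad u - lip_const * eta).
apply: (@le_trans _ _ (EE p m G)%:E).
  rewrite lee_fin -(EE_cst (cell_prob_sum rho mc) m (lip_const * eta)).
  rewrite lerBlDr -EED; apply: EE_le_tuple => [t|u]; first exact: cell_prob_ge0.
  by rewrite -lerBlDr le_max lexx orbT.
rewrite -(integral_cell_seq iid mc) => [|u]; last by rewrite le_max lexx.
apply: ge0_le_integralT => w; first by rewrite lee_fin le_max lexx.
have sD i : labelled X (sample Zs w i) by exact: ZsD.
have rad0 sigma : 0 <= rad_sup N X (sample Zs w) sigma.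
  exact: (rad_sup_ge0 normN X0 XM c0_gt0 c0N).
rewrite lee_fin /G ge_max; apply/andP; split.
  by rewrite mulr_ge0 ?invr_ge0// sumr_ge0.
rewrite cell_rad_tuple lerBlDr.
have -> : lip_const * eta = (2 ^ m)%:R^-1 *
    \sum_(sigma : {ffun 'I_m -> bool}) lip_const * eta.
  by rewrite sumr_const card_ffun card_bool card_ord -(mulr_natl (_ * _)) mulKf//.
rewrite -mulrDr ler_wpM2l ?invr_ge0// -big_split /=; apply: ler_sum => sigma _.
apply: le_trans (rad_sup_close (eta := eta) m0 normN X0 XM c0_gt0 c0N sigma _ sD _) _.
- by move=> i; exact: repD.
- by move=> i; rewrite tnth_mktuple; apply: c_close => //; exact: c_rep.
- by rewrite lerD2l le_eqVlt /lip_const; apply/orP; left; apply/eqP; ring.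
Qed.

Lemma rad_term_le :
  EE p m (fun u => EE (@fair_coin R) m (fun e =>
    supF F (fun f => 2 * \sum_(q <- zip e u) sgn R q.1 * h f q.2))) <=
  2 * m%:R / (lambda * r) * EE p m cell_rad.
Proof.
rewrite -EEZ; apply: EE_le_tuple => [t|u]; first exact: cell_prob_ge0.
rewrite EE_fair_coin cell_rad_tuple mulrCA ler_wpM2l ?invr_ge0// mulr_sumr.
apply: ler_sum => sigma _; apply: supF_le; first exact: kernel_class_nonempty.
move=> f Ff; rewrite sum_zip_tuple.
under eq_bigr do rewrite tnth_mktuple /=.
rewrite -!mulrA ler_wpM2l//.
have := kernel_class_rad m0 normN X0 XM c0_gt0 c0N lambda0 sigma Ff
  (fun i => repD (tnth u i)).
by rewrite mulrAC -mulrA.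
Qed.

(** Three estimates are chained: from the risk to the expected loss at representatives
    ([gen_err_le]), to its average over the cells of the sample ([uniform_deviation], divided by
    [m]), to the empirical risk ([emp_hinge_ge]). The first and the last cost [K * eta] each. *)
Lemma approx_event L : 0 <= L ->
  exists E : set Omega, [/\ measurable E, ((1 - expR (- L))%:E <= P E)%E &
    forall w f, E w -> F f ->
    (gen_err rho f <= (emp_hinge (sample Zs w) f + 2 * K * eta +
      2 / (lambda * r) * EE p m cell_rad +
      2 * B * Num.sqrt (2 * L / m%:R))%:E)%E].
Proof.
move=> L0; have B0 : 0 < B.
  rewrite /B ltr_wpDl// divr_ge0 ?mulr_ge0 ?(ltW lambda0) ?(ltW r0)//.
  exact: (Xstar_ge0 normN X0 XM c0_gt0 c0N).
have [Q [PQ dev]] := uniform_deviation kernel_class_nonempty (cell_prob_ge0 rho c)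
  (cell_prob_sum rho mc) loss_lip rep_bound m0 B0 L0.
exists [set w | Q (U w)]; split.
- exact: (measurable_cell_event iid mc Q).
- by rewrite (cell_event_prob iid mc Q) lee_fin.
move=> w f Qw Ff; have dw := dev _ _ Qw Ff.
apply: (le_trans (gen_err_le Ff)); rewrite lee_fin.
have {}dw := le_trans dw (lerD rad_term_le (lexx _)).
have mR : 0 < m%:R :> R by rewrite ltr0n.
have e1 := emp_hinge_ge w Ff.
have sqm : Num.sqrt (2 * L * m%:R) = m%:R * Num.sqrt (2 * L / m%:R).
  have -> : 2 * L * m%:R = m%:R ^+ 2 * (2 * L / m%:R) by field; rewrite gt_eqF.
  by rewrite sqrtrM ?sqr_ge0// sqrtr_sqr ger0_norm ?ltW.
move: dw; rewrite sqm sumrB big_tuple sumr_const card_ord -/(expl _ _ _ _) => dw.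
rewrite ler_pdivrMl// in e1.
have : m%:R * expl p l h f <= m%:R * (emp_hinge (sample Zs w) f + K * eta +
    2 / (lambda * r) * EE p m cell_rad + 2 * B * Num.sqrt (2 * L / m%:R)).
  rewrite -(mulr_natl (expl _ _ _ _)) in dw; rewrite -/p in dw.
  lra.
rewrite ler_pM2l//; lra.
Qed.

End fixed_cells.

Lemma rademacher_ge0 : (0 <= rademacher P Zs N X)%E.
Proof.
apply: integral_ge0 => w _; rewrite lee_fin mulr_ge0 ?invr_ge0// sumr_ge0// => sigma _.
by apply: (rad_sup_ge0 normN X0 XM c0_gt0 c0N) => i; exact: ZsD.
Qed.

(** A labelled point is chosen in each cell that contains one; every other cell receives a labelled
    point from elsewhere. *)
Lemma exists_representatives (T : Type) (c : Zt R d -> T) :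
  exists rep : T -> Zt R d, (forall t, labelled X (rep t)) /\
    (forall z, labelled X z -> c (rep (c z)) = c z).
Proof.
have [x Xx] := X0.
pose z0 : Zt R d := ([tuple x i 0 | i < d], 1).
have z0D : labelled X z0.
  split; last by left.
  rewrite (_ : vec _ = x)//; apply/matrixP => i j.
  by rewrite mxE tnth_mktuple ord1.
have /choice[rep repP] (t : T) : exists z, labelled X z /\
    ((exists2 z', labelled X z' & c z' = t) -> c z = t).
  have [[z Dz cz]|nz] := pselect (exists2 z', labelled X z' & c z' = t).
    by exists z.
  by exists z0.
exists rep; split => [t|z Dz]; first exact: (repP t).1.
by apply: (repP (c z)).2; exists z.
Qed.

(** Coefficient of [eta] in the total error: its terms come from the losses, from [rademacher_ge],
    and from the [eta] in the bound on the class. *)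
Definition slack L : R :=
  2 * K + 2 / (lambda * r) * lip_const + 2 * Num.sqrt (2 * L / m%:R).

Lemma approx_bound L eta : 0 <= L -> 0 < eta ->
  exists E : set Omega, [/\ measurable E, ((1 - expR (- L))%:E <= P E)%E &
    forall w f, E w -> kernel_class m N X r lambda f ->
    (gen_err rho f <= (emp_hinge (sample Zs w) f)%:E +
      (4 / (lambda * r))%:E * rademacher P Zs N X +
      (2 * Xstar N X / (lambda * r) * Num.sqrt (2 * L / m%:R))%:E +
      (slack L * eta)%:E)%E].
Proof.
move=> L0 eta0.
have [T [c [mc c_close]]] := exists_cells XM eta0.
have [rep [repD c_rep]] := exists_representatives c.
have [E [mE PE EF]] := approx_event eta0 mc c_close repD c_rep L0.
exists E; split => // w f Ew Ff; apply: le_trans (EF w f Ew Ff) _.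
have := rademacher_ge mc c_close repD c_rep.
have := rademacher_ge0.
have lr0 : 0 < (lambda * r)^-1 by rewrite invr_gt0 mulr_gt0.
(* The value [+oo] makes the bound trivial, and [rademacher_ge0] excludes [-oo]. *)
case: (rademacher P Zs N X) => [v| |]//.
  rewrite -EFinM -!EFinD !lee_fin => v0 vge; rewrite /slack.
  set e := EE _ _ _ in vge *.
  have : 2 / (lambda * r) * e <=
      4 / (lambda * r) * v + 2 / (lambda * r) * lip_const * eta.
    have h := ler_wpM2l (ltW lr0) vge; have := mulr_ge0 (ltW lr0) v0; lra.
  lra.
by move=> _ _; rewrite gt0_muley ?lte_fin ?divr_gt0 ?mulr_gt0// addey// leey.
Qed.

Lemma generalization_event L : 0 <= L ->
  exists E : set Omega, [/\ measurable E, ((1 - expR (- L))%:E <= P E)%E &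
    forall w f, E w -> kernel_class m N X r lambda f ->
    (gen_err rho f <= (emp_hinge (sample Zs w) f)%:E +
      (4 / (lambda * r))%:E * rademacher P Zs N X +
      (2 * Xstar N X / (lambda * r) * Num.sqrt (2 * L / m%:R))%:E)%E].
Proof.
move=> L0.
have eta_gt0 (n : nat) : 0 < n.+1%:R^-1 :> R by rewrite invr_gt0.
have /choice[E EP] (n : nat) := approx_bound L0 (eta_gt0 n).
have mE n : measurable (E n) by have [] := EP n.
have mU n : measurable (\bigcup_(k in [set k | (n <= k)%N]) E k).
  by apply: bigcup_measurable => k _.
exists (lim_sup_set E); split.
- by apply: bigcapT_measurable => n; exact: mU.
(* The limit superior is the decreasing limit of the tail unions, and the tail from [n] contains
   [E n], so the lower bound on probabilities passes to the limit. *)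
- have U_lty : (P (\bigcup_(k in [set k | (0 <= k)%N]) E k) < +oo)%E.
    by rewrite (le_lt_trans (probability_le1 P (mU 0%N)))// ltry.
  have cvgP := lim_sup_set_cvg P E mE U_lty.
  rewrite -(cvg_lim _ cvgP)//; apply: lime_ge; first by apply/cvg_ex; eexists; exact: cvgP.
  apply: nearW => n; have [_ PE _] := EP n; apply: le_trans PE _.
  by apply: le_measure; rewrite ?inE//; apply: bigcup_sup => /=.
move=> w f Ew Ff; apply/lee_addgt0Pr => e e0.
(* For this [k] one has [slack L / (k + 1) <= e], since [slack L / e] is less than its integer part
   plus one. *)
have [k /= nk Ekw] := Ew (Num.truncn (slack L / e)) Logic.I.
have [_ _ /(_ w f Ekw Ff) h] := EP k; apply: le_trans h _.
rewrite leeD2l// lee_fin ler_pdivrMr// mulrC -ler_pdivrMr//.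
apply: le_trans (ltW (truncnS_gt _)) _.
by rewrite ler_nat ltnS.
Qed.

End approximation.

Theorem theorem2 (R : realType) (d m : nat) (X : set 'cV[R]_d)
  (rho : probability (Zt R d) R)
  (d0 : measure_display) (Omega : measurableType d0)
  (P : probability Omega R) (Zs : 'I_m -> Omega -> Zt R d)
  (r lambda : R) (N : 'M[R]_d -> R)
  (Az : ('I_m -> Zt R d) -> 'M[R]_d)
  (alpha : ('I_m -> Zt R d) -> 'I_m -> R) (delta : R) :
  (0 < m)%N ->
  bounded_domain X ->
  rho [set z | X (vec z.1) /\ (z.2 = 1 \/ z.2 = -1)] = 1%E ->
  iid_sample P Zs rho ->
  (forall i w, X (vec (Zs i w).1) /\ ((Zs i w).2 = 1 \/ (Zs i w).2 = -1)) ->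
  0 < r -> 0 < lambda ->
  matrix_norm N ->
  (* A_z is a minimizer of E_z(A) + lambda ||A|| over symmetric matrices *)
  (forall s, sym_mx (Az s) /\
     forall A, sym_mx A ->
       emp_err r s (Az s) + lambda * N (Az s) <= emp_err r s A + lambda * N A) ->
  (* f_z = sum_j alpha_j K_{A_z}(x_j, .) minimizes the empirical hinge risk
     over sum_j |alpha_j| <= 1/r *)
  (forall s, \sum_(j < m) `|alpha s j| <= r^-1 /\
     forall beta : 'I_m -> R, \sum_(j < m) `|beta j| <= r^-1 ->
       emp_hinge s (fA s (Az s) (alpha s)) <= emp_hinge s (fA s (Az s) beta)) ->
  0 < delta < 1 ->
  exists E : set Omega, measurable E /\ ((1 - delta)%:E <= P E)%E /\
    forall w, E w ->
      let s := sample Zs w in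
      (gen_err rho (fA s (Az s) (alpha s)) <=
         (emp_err r s (Az s))%:E
         + (4 / (lambda * r))%:E * rademacher P Zs N X
         + (2 * Xstar N X / (lambda * r) *
              Num.sqrt (2 * ln (delta^-1) / m%:R))%:E)%E.
Proof.
move=> m0 [X0 [_ [_ bX]]] _ iid ZsD r0 lambda0 normN minA minalpha /andP[delta0 delta1].
have [M M0 XM] : exists2 M, 0 <= M & forall x, X x -> forall i, `|x i 0| <= M.
  have [M [_ XM]] := bX.
  (* [bounded_set] gives a bound by every number strictly above its [M]. *)
  exists (`|M| + 1); first by rewrite addr_ge0.
  move=> x Xx i; rewrite (le_trans (entry_le_mx_norm _ _ _))// XM//.
  by rewrite (le_lt_trans (ler_norm _))// ltrDl.
have [c0 c0_gt0 c0N] := entry_le_matrix_norm normN.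
have L0 : 0 <= ln (delta^-1) by rewrite ln_ge0// invf_ge1// ltW.
have [E [mE PE EF]] := generalization_event m0 iid ZsD r0 lambda0 normN X0 M0 XM c0_gt0 c0N L0.
exists E; split => //; split.
  by move: PE; rewrite lnV ?posrE// opprK lnK ?posrE.
move=> w Ew /=; set s := sample Zs w.
have [symA /(_ 0) minA0] := minA s; have [aB minalphas] := minalpha s.
have sD i : labelled X (s i) by exact: ZsD.
have fF : kernel_class m N X r lambda (fA s (Az s) (alpha s)).
  exists (Az s), (alpha s), (xs s); split => //.
  - by apply: (minimizer_norm_le m0 normN lambda0 (minA0 _)); rewrite /sym_mx /= trmx0.
  - by move=> i; case: (sD i).
rewrite (le_trans (EF w _ Ew fF))// -!addeA leeD2r// lee_fin.
exact: (emp_hinge_le m0 r0 symA sD minalphas).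
Qed.
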